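(* Let $f$ be a real analytic function on an open neighborhood of $0\in\mathbb{R}^n$ with $f(0)=0$ and $f\not\equiv 0$. Then for every open neighborhood $\mathcal{U}$ of $0$ contained in the domain of $f$, \[ \int_{\mathcal{U}} \left|\frac{\nabla f}{f}\right|^n \, dV(x) = \infty. \]
   Formalization: The condition f ≢ 0 is taken to mean that f does not vanish identically on any neighborhood of 0; on a connected domain this is equivalent to f ≢ 0, and on a disconnected domain the claim fails if f vanishes on the component of 0. *)

(* Defs.v *)
From HB Require Import structures.
From mathcomp Require Import all_boot all_order all_algebra.
From mathcomp Require Import all_classical all_reals all_analysis.
Set Implicit Arguments. Unset Strict Implicit. Unset Printing Implicit Defensive.
Import Order.TTheory GRing.Theory Num.Theory.
Import numFieldNormedType.Exports.
Local Open Scope classical_set_scope.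
Local Open Scope ring_scope.

(* R^n is modelled by row vectors 'rV[R]_n (topology, derivatives) and by
   n.-tuples (product/Borel sigma-algebra, for the measure). *)

Definition monom (R : realType) (n : nat) (alpha : 'I_n -> nat) (h : 'rV[R]_n) : R :=
  \prod_(i < n) h 0 i ^+ alpha i.

Definition hom_part (R : realType) (n : nat) (c : ('I_n -> nat) -> R)
    (k : nat) (h : 'rV[R]_n) : R :=
  \sum_(a : {ffun 'I_n -> 'I_k.+1} | \sum_(i < n) (a i : nat) == k)
     c (fun i => (a i : nat)) * monom (fun i => (a i : nat)) h.

Definition abs_hom_part (R : realType) (n : nat) (c : ('I_n -> nat) -> R)
    (k : nat) (h : 'rV[R]_n) : R :=
  \sum_(a : {ffun 'I_n -> 'I_k.+1} | \sum_(i < n) (a i : nat) == k)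
     `| c (fun i => (a i : nat)) * monom (fun i => (a i : nat)) h |.

Definition analytic_at (R : realType) (n : nat) (f : 'rV[R]_n -> R)
    (a : 'rV[R]_n) : Prop :=
  exists (c : ('I_n -> nat) -> R) (r : R), 0 < r /\
    forall h : 'rV[R]_n, `|h| < r ->
      cvg (series (fun k => abs_hom_part c k h) @ \oo) /\
      (series (fun k => hom_part c k h) @ \oo --> f (a + h)).

Definition partial (R : realType) (n : nat) (i : 'I_n) (f : 'rV[R]_n -> R)
    (x : 'rV[R]_n) : R :=
  'D_(delta_mx 0 i) f x.

(* |grad f (x) / f(x)|^n, Euclidean norm; by Rocq's convention y / 0 = 0,
   so the integrand is 0 on the zero set of f (a null set). *)
Definition log_grad_pow (R : realType) (n : nat) (f : 'rV[R]_n -> R)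
    (x : 'rV[R]_n) : R :=
  Num.sqrt (\sum_(i < n) (partial i f x / f x) ^+ 2) ^+ n.

Definition row_of_tuple (R : realType) (n : nat) (t : n.-tuple R) : 'rV[R]_n :=
  \row_(i < n) tnth t i.

(* mu is Lebesgue measure on R^n (on the Borel = product sigma-algebra of
   n.-tuple R): it gives every half-open box its volume. *)
Definition is_lebesgue_measure (R : realType) (n : nat)
    (mu : {measure set (n.-tuple R) -> \bar R}) : Prop :=
  forall a b : n.-tuple R, (forall i, tnth a i <= tnth b i) ->
    mu [set x | forall i, tnth a i < tnth x i <= tnth b i] =
    (\prod_(i < n) (tnth b i - tnth a i))%:E.

(* Main.v *)
(* Let P_k be the first nonzero homogeneous part of the Taylor series of f at
   0; k >= 1 because f(0) = 0. By Euler's identity x . grad P_k = k P_k, so on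
   a narrow cone around a direction where P_k does not vanish both f(x) and the
   radial derivative x . grad f(x) are of exact order |x|^k, and therefore
   |grad f / f| >= C / |x|. On the dyadic dilates 2^-j B of a small box B in
   that cone the integrand is thus at least of order 2^(jn), while their volume
   is of order 2^(-jn): infinitely many disjoint pieces each contribute at
   least a fixed positive amount. The pieces are added up through simple
   functions below the integrand, which avoids proving it measurable. *)
Require Import Defs.
From HB Require Import structures.
From mathcomp Require Import all_boot all_order all_algebra.
From mathcomp Require Import all_classical all_reals all_analysis.
From mathcomp Require Import ring lra.
Set Implicit Arguments.
Unset Strict Implicit.
Unset Printing Implicit Defensive.
Import Order.TTheory GRing.Theory Num.Theory.
Import numFieldNormedType.Exports.
Import HBNNSimple.
Local Open Scope classical_set_scope.
Local Open Scope ring_scope.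

(** * Elementary estimates: geometric tails and the maximum norm *)

Lemma series_remainder (R : realType) (u : nat -> R) (l M th : R) (k : nat) :
  0 <= th <= 2^-1 -> (forall m, `|u m| <= M * th ^+ m) ->
  series u @ \oo --> l -> `|l - series u k| <= 2 * M * th ^+ k.
Proof.
move=> /andP[th0 th2] hu ul.
have M0 : 0 <= M by have := hu 0%N; rewrite expr0 mulr1; apply: le_trans.
(* The subtracted power lets the induction close: [th <= 2^-1] gives
   [th ^+ m <= 2 * (th ^+ m - th ^+ m.+1)], so the bounds telescope. *)
have H N : `|series u (N + k)%N - series u k| <=
           2 * M * (th ^+ k - th ^+ (N + k)).
  elim: N => [|N IH]; first by rewrite add0n !subrr normr0 mulr0.
  rewrite addSn seriesSr addrAC (le_trans (ler_normD _ _))//.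
  rewrite (le_trans (lerD IH (hu _)))// exprS.
  have : (M * th ^+ (N + k)) * th <= (M * th ^+ (N + k)) * 2^-1.
    by rewrite ler_wpM2l// mulr_ge0// exprn_ge0.
  by nra.
have ul' : (fun N => series u (N + k)%N - series u k) @ \oo --> l - series u k.
  by apply: cvgB; [rewrite (cvg_shiftn k (series u)) | exact: cvg_cst].
apply: (ler_cvg_to (cvg_norm ul') (cvg_cst (2 * M * th ^+ k))).
apply: nearW => N; apply: (le_trans (H N)).
by rewrite ler_wpM2l ?mulr_ge0// gerBl exprn_ge0.
Qed.

(** Controls radial increments of a degree [m] part, linearly in the step [s]. The crude base 4
    makes the induction easy and is absorbed by shrinking the radius. *)
Lemma expr1D_sub1_le (R : realType) (s : R) (m : nat) :
  0 <= s <= 1 -> 0 <= (1 + s) ^+ m - 1 <= s * 4 ^+ m.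
Proof.
move=> /andP[s0 s1]; elim: m => [|m /andP[IH0 IH]].
  by rewrite !expr0 subrr mulr1 lexx s0.
have p1 : s * 1 <= s * 4 ^+ m by rewrite ler_wpM2l// exprn_ege1// ler1n.
rewrite !exprS; move: IH0 IH p1.
by set a := (1 + s) ^+ m; set b := 4 ^+ m => *; apply/andP; split; nra.
Qed.

Lemma mx_entry_norm_le (R : realType) (n : nat) (h : 'rV[R]_n) (i : 'I_n) :
  `|h 0 i| <= `|h|.
Proof.
rewrite [leRHS]/Num.Def.normr /= mx_normrE.
by apply/bigmax_geP; right => /=; exists (0, i).
Qed.

Lemma mx_norm_le (R : realType) (n : nat) (h : 'rV[R]_n) (e : R) :
  0 <= e -> (forall i, `|h 0 i| <= e) -> `|h| <= e.
Proof.
move=> e0 he; rewrite [leLHS]/Num.Def.normr /= mx_normrE.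
by apply: bigmax_le => // -[i j] _ /=; rewrite (ord1 i).
Qed.

(** * Homogeneous parts of a power series *)

Lemma monomZ (R : realType) (n : nat) (alpha : 'I_n -> nat) (t : R)
    (h : 'rV[R]_n) :
  monom alpha (t *: h) = t ^+ (\sum_(i < n) alpha i) * monom alpha h.
Proof.
rewrite /monom expr_sum -big_split /=; apply: eq_bigr => i _.
by rewrite mxE exprMn.
Qed.

Lemma hom_partZ (R : realType) (n : nat) (c : ('I_n -> nat) -> R) (k : nat)
    (t : R) (h : 'rV[R]_n) :
  hom_part c k (t *: h) = t ^+ k * hom_part c k h.
Proof.
rewrite /hom_part mulr_sumr; apply: eq_bigr => a /eqP ak.
by rewrite monomZ ak mulrCA.
Qed.

Lemma hom_part_continuous (R : realType) (n : nat) (c : ('I_n -> nat) -> R)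
    (k : nat) : continuous (hom_part c k).
Proof.
apply: continuous_big => [|a _ x]; first exact: add_continuous.
apply: continuousM; first exact: cst_continuous.
apply: continuous_big => [|i _ {}x]; first exact: mul_continuous.
apply: (@continuous_comp _ _ _ (fun h : 'rV[R]_n => h 0 i) (fun y => y ^+ _)).
  exact: coord_continuous.
exact: exprn_continuous.
Qed.

(** In the maximum norm every coordinate of [h] is at most [rho * (|h| / rho)], so each monomial is
    compared with its value at one constant vector. *)
Lemma hom_part_le (R : realType) (n : nat) (c : ('I_n -> nat) -> R) (m : nat)
    (rho : R) (h : 'rV[R]_n) :
  0 < rho ->
  `|hom_part c m h| <= abs_hom_part c m (const_mx rho) * (`|h| / rho) ^+ m.
Proof.
move=> rho0; rewrite /hom_part /abs_hom_part (le_trans (ler_norm_sum _ _ _))//.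
rewrite mulr_suml; apply: ler_sum => a /eqP am.
rewrite !normrM -mulrA ler_wpM2l//.
have -> : (`|h| / rho) ^+ m = \prod_(i < n) (`|h| / rho) ^+ a i.
  by rewrite -expr_sum am.
rewrite /monom !normr_prod -big_split /=.
apply: ler_prod => i _; rewrite normr_ge0 /= mxE !normrX -exprMn.
have th0 : 0 <= `|h| / rho by rewrite divr_ge0// ltW.
apply: lerXn2r; rewrite ?nnegrE//; first exact: mulr_ge0.
by rewrite (gtr0_norm rho0) mulrC divfK ?gt_eqF// mx_entry_norm_le.
Qed.

(** A multi-index of degree 1 has a single exponent 1, so its monomial is one coordinate, which is
    linear. *)
Lemma hom_part1_linear (R : realType) (n : nat) (c : ('I_n -> nat) -> R)
    (h : 'rV[R]_n) :
  hom_part c 1 h = \sum_(i < n) h 0 i * hom_part c 1 (delta_mx 0 i).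
Proof.
have E (g : 'rV[R]_n) (a : {ffun 'I_n -> 'I_2}) :
    (\sum_(i < n) (a i : nat))%N == 1%N ->
    monom (fun i => (a i : nat)) g = \sum_(i < n) g 0 i * (a i : nat)%:R.
  move=> a1.
  have [j aj] : exists j, (a j : nat) == 1%N.
    apply/existsP; move: a1; apply: contraTT; rewrite negb_exists => /forallP a0.
    rewrite big1// => i _; have := a0 i; have := ltn_ord (a i).
    by case: (a i : nat) => [|[|]].
  have ai i : i != j -> (a i : nat) = 0%N.
    move: a1; rewrite (bigD1 j)//= (eqP aj) eqSS sum_nat_eq0 => /forallP a0 ij.
    by have := a0 i; rewrite ij => /eqP.
  rewrite /monom (bigD1 j)//= [in RHS](bigD1 j)//= (eqP aj) expr1 mulr1.
  rewrite big1 ?mulr1 => [|i ij]; last by rewrite ai// expr0.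
  by rewrite big1 ?addr0// => i ij; rewrite ai// mulr0.
have D (a : {ffun 'I_n -> 'I_2}) i :
    \sum_(j < n) (delta_mx 0 i : 'rV[R]_n) 0 j * (a j : nat)%:R = (a i : nat)%:R.
  rewrite (bigD1 i)//= mxE !eqxx mul1r big1 ?addr0// => j ji.
  by rewrite mxE (negbTE ji) andbF mul0r.
rewrite /hom_part; under [in RHS]eq_bigr do rewrite mulr_sumr.
rewrite exchange_big /=; apply: eq_bigr => a a1.
rewrite E// mulr_sumr; apply: eq_bigr => i _.
by rewrite E// D mulrCA.
Qed.

Lemma hom_part0 (R : realType) (n : nat) (c : ('I_n -> nat) -> R)
    (h : 'rV[R]_n) : hom_part c 0 h = hom_part c 0 0.
Proof. by rewrite -(scale0r h) hom_partZ expr0 mul1r. Qed.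

Lemma series_low_zero (R : realType) (u : nat -> R) (k : nat) :
  (forall m, (m < k)%N -> u m = 0) -> series u k = 0.
Proof.
by move=> u0; rewrite /series /= big_nat_cond big1// => m /andP[/andP[_ /u0]].
Qed.

(** * Bounds and derivatives of analytic functions *)

(** Terms of a convergent series are bounded; at the constant vector [r / 2] this yields Cauchy-type
    estimates in all degrees at once. *)
Lemma analytic_at_bound (R : realType) (n : nat) (f : 'rV[R]_n -> R)
    (a : 'rV[R]_n) : analytic_at f a ->
  exists (c : ('I_n -> nat) -> R) (rho M : R), [/\ 0 < rho, 0 < M,
    forall m h, `|hom_part c m h| <= M * (`|h| / rho) ^+ m &
    forall h, `|h| < rho -> series (fun m => hom_part c m h) @ \oo --> f (a + h)].
Proof.
move=> [c [r [r0 H]]]; exists c, (r / 2).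
have rho0 : 0 < r / 2 by rewrite divr_gt0.
have nrho : `|const_mx (r / 2) : 'rV[R]_n| < r.
  apply: (@le_lt_trans _ _ (r / 2)); last by lra.
  by apply: mx_norm_le => [|i]; rewrite ?mxE ?gtr0_norm// ltW.
have [/cvg_series_bounded bd _] := H _ nrho.
have [B [Breal hB]] := bd.
pose M := Num.max B 0 + 1; exists M.
have M0 : 0 < M by rewrite /M ltr_wpDl// le_max lexx orbT.
split=> // [m h|h hr]; last by apply: (H _ _).2; lra.
apply: (le_trans (hom_part_le c m h rho0)).
apply: ler_wpM2r; first by rewrite exprn_ge0// divr_ge0// ltW.
have BM : B < M by rewrite /M ltr_pwDr// le_max lexx.
by apply: le_trans (hB M BM m I); exact: ler_norm.
Qed.

(** The tail from degree 2 on is geometric; restricting to [|h| < rho / 2] keeps its ratio at most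
    1/2. *)
Lemma analytic_at_first_order (R : realType) (n : nat) (f : 'rV[R]_n -> R)
    (a : 'rV[R]_n) : analytic_at f a ->
  exists (c : ('I_n -> nat) -> R) (e C : R), 0 < e /\
    forall h, `|h| < e -> `|f (a + h) - f a - hom_part c 1 h| <= C * `|h| ^+ 2.
Proof.
move=> /analytic_at_bound[c [rho [M [rho0 M0 hP cvP]]]].
exists c, (rho / 2), (2 * M / rho ^+ 2); split=> [|h he]; first by rewrite divr_gt0.
have hr : `|h| < rho by lra.
(* At [h = 0] the ratio is 0, so the remainder after one term vanishes. *)
have fa : f a = hom_part c 0 0.
  have cv0 := cvP 0; rewrite normr0 addr0 in cv0.
  have := @series_remainder _ _ _ M (`|0 : 'rV[R]_n| / rho) 1 _
    (fun m => hP m 0) (cv0 rho0).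
  rewrite normr0 mul0r lexx invr_ge0 ler0n => /(_ isT).
  rewrite expr1 mulr0 normr_le0 subr_eq0 => /eqP ->.
  by rewrite /series /= big_nat1.
have := @series_remainder _ _ _ M (`|h| / rho) 2 _ (fun m => hP m h) (cvP h hr).
rewrite divr_ge0 ?(ltW rho0)//= ler_pdivrMr// mulrC (ltW he) => /(_ isT).
rewrite /series /= big_nat_recr//= big_nat1 hom_part0 -fa.
by rewrite opprD addrA expr_div_n mulrA mulrAC.
Qed.

Lemma analytic_at_derive (R : realType) (n : nat) (f : 'rV[R]_n -> R)
    (a : 'rV[R]_n) : analytic_at f a ->
  (forall v, derivable f a v) /\
  (forall v, 'D_v f a = \sum_(i < n) v 0 i * partial i f a).
Proof.
move=> /analytic_at_first_order[c [e [C [e0 H]]]].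
have cv v : h^-1 *: ((f \o shift a) (h *: v) - f a) @[h --> 0^'] --> hom_part c 1 v.
  (* Adding 1 keeps the radius [e / (|v| + 1)] meaningful for [v = 0]. *)
  have v1 : 0 < `|v| + 1 by rewrite ltr_wpDl.
  apply/subr_cvg0; apply: (@cvg_to_0_linear _ _ (C * `|v| ^+ 2) (e / (`|v| + 1))).
    by rewrite divr_gt0.
  move=> r /andP[r0 re].
  have rN : r != 0 by rewrite -normr_gt0.
  have rv : `|r *: v| < e.
    rewrite normrZ; move: re; rewrite ltr_pdivlMr// => /(le_lt_trans _); apply.
    by rewrite ler_wpM2l// lerDl.
  have := H _ rv; rewrite hom_partZ expr1 [a + _]addrC => hh.
  rewrite /= -[hom_part c 1 v](mulKf rN) -[_ *: _]/(_ * _) -mulrBr normrM normfV.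
  rewrite ler_pdivrMl//; apply: (le_trans hh).
  by rewrite normrZ exprMn; rewrite le_eqVlt; apply/orP; left; apply/eqP; ring.
have E v : 'D_v f a = hom_part c 1 v by apply: cvg_lim.
split=> v; first by apply/cvg_ex; exists (hom_part c 1 v); exact: cv.
by rewrite E hom_part1_linear; apply: eq_bigr => i _; rewrite /partial E.
Qed.

(** * Radial derivative and leading part *)

(* Euler's identity in quantitative form: along the ray through [x] the
   difference quotients of [f] are dominated by those of the leading part. *)
Lemma radial_derive_ge (R : realType) (n : nat) (f : 'rV[R]_n -> R)
    (c : ('I_n -> nat) -> R) (rho M : R) (k : nat) (x : 'rV[R]_n) :
  0 < rho ->
  (forall m h, `|hom_part c m h| <= M * (`|h| / rho) ^+ m) ->
  (forall h, `|h| < rho -> series (fun m => hom_part c m h) @ \oo --> f h) ->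
  (0 < k)%N -> (forall m, (m < k)%N -> hom_part c m x = 0) ->
  `|x| <= rho / 8 -> derivable f x x ->
  `|hom_part c k x| - 2 * M * (4 * (`|x| / rho)) ^+ k.+1 <= `|'D_x f x|.
Proof.
move=> rho0 hP cvP k0 hk xr dfx.
set th := `|x| / rho.
have th0 : 0 <= th by rewrite divr_ge0// ltW.
have th8 : th <= 8^-1 by rewrite ler_pdivrMr// mulrC.
have Hs s : 0 < s -> s <= 1 ->
    `|hom_part c k x| - 2 * M * (4 * th) ^+ k.+1 <=
    `|s^-1 *: ((f \o shift x) (s *: x) - f x)|.
  move=> s0 s1.
  have sx : s *: x + x = (1 + s) *: x by rewrite scalerDl scale1r addrC.
  have nx0 : 0 <= `|x| by [].
  have c1 : series (fun m => hom_part c m ((1 + s) *: x)) @ \oo --> f ((1 + s) *: x).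
    by apply: cvP; rewrite normrZ gtr0_norm; nra.
  have c2 : series (fun m => hom_part c m x) @ \oo --> f x by apply: cvP; lra.
  (* By homogeneity these are the terms of the increment of [f] from [x] to [(1 + s) *: x]; the
     first that can be nonzero has degree [k]. *)
  pose u m := ((1 + s) ^+ m - 1) * hom_part c m x.
  have cu : series u @ \oo --> f ((1 + s) *: x) - f x.
    rewrite (_ : series u = series (fun m => hom_part c m ((1 + s) *: x)) -
                            series (fun m => hom_part c m x)); first exact: cvgB.
    apply/funext => N; rewrite /series /= fctE -sumrB; apply: eq_bigr => m _.
    by rewrite /u hom_partZ mulrBl mul1r.
  (* The factor [s] cancels in the difference quotient, and [|x| <= rho / 8] makes the ratio
     [4 * th] at most 1/2. *)
  have hu m : `|u m| <= (s * M) * (4 * th) ^+ m.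
    have := @expr1D_sub1_le _ s m; rewrite (ltW s0) s1 => /(_ isT)/andP[p0 p1].
    rewrite /u normrM (ger0_norm p0).
    apply: (le_trans (ler_pM _ _ p1 (hP _ _))) => //.
    by rewrite -/th [(4 * th) ^+ m]exprMn le_eqVlt; apply/orP; left; apply/eqP; ring.
  have := @series_remainder _ _ _ _ _ k.+1 _ hu cu.
  have -> : series u k.+1 = u k.
    by rewrite seriesSr series_low_zero ?add0r// => m mk; rewrite /u hk// mulr0.
  have -> : 0 <= 4 * th <= 2^-1 by apply/andP; split; lra.
  move=> /(_ isT) hr.
  rewrite /= sx normrZ normfV (gtr0_norm s0) ler_pdivlMl//.
  (* Since [k] is positive, [(1 + s) ^+ k - 1 >= s]. *)
  have uk : s * `|hom_part c k x| <= `|u k|.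
    rewrite /u normrM ler_wpM2r// ger0_norm.
      case: k k0 {hk hr} => // k _; rewrite exprS.
      have : 1 <= (1 + s) ^+ k by rewrite exprn_ege1// lerDl ltW.
      by nra.
    by rewrite subr_ge0 exprn_ege1// lerDl ltW.
  have := lerB_dist (u k) (f ((1 + s) *: x) - f x); rewrite [X in _ <= X]distrC.
  move: hr uk; set A := `|_ - u k|; set B := `|u k|; set F := `|_ - f x|.
  by nra.
have cv : `|s^-1 *: ((f \o shift x) (s *: x) - f x)| @[s --> 0^'+] -->
    `|'D_x f x|.
  by apply: cvg_dnbhs_at_right; apply: cvg_norm; exact: dfx.
rewrite -(cvg_lim _ cv)//; apply: limr_ge; first by apply/cvg_ex; eexists; exact: cv.
near=> s; apply: Hs => //.
by near: s; apply: nbhs_right_le.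
Unshelve. all: by end_near. Qed.

(** If all parts vanished, [f] would be zero on the ball of radius [rho]; [f 0 = 0] removes degree
    0. *)
Lemma leading_part_exists (R : realType) (n : nat) (f : 'rV[R]_n -> R)
    (c : ('I_n -> nat) -> R) (rho : R) :
  0 < rho ->
  (forall h, `|h| < rho -> series (fun m => hom_part c m h) @ \oo --> f h) ->
  f 0 = 0 -> ~ (\forall x \near (0 : 'rV[R]_n), f x = 0) ->
  exists (k : nat) (x0 : 'rV[R]_n), [/\ (0 < k)%N,
    forall m h, (m < k)%N -> hom_part c m h = 0 & hom_part c k x0 != 0].
Proof.
move=> rho0 cvP f0 fN0.
(* A series reduced to its first term obeys the geometric bound with ratio 0, because
   [0 ^+ 0 = 1]. *)
have zero_sum h : `|h| < rho -> (forall m, (0 < m)%N -> hom_part c m h = 0) ->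
    f h = hom_part c 0 h.
  move=> hr h0; pose M := `|hom_part c 0 h|.
  have := @series_remainder _ _ _ M 0 1 _ _ (cvP h hr).
  rewrite lexx invr_ge0 ler0n => /(_ isT) H.
  have /H : forall m, `|hom_part c m h| <= M * 0 ^+ m.
    case=> [|m]; first by rewrite expr0 mulr1.
    by rewrite h0// normr0 exprS mul0r mulr0.
  rewrite expr1 mulr0 normr_le0 subr_eq0 => /eqP ->.
  by rewrite /series /= big_nat1.
have P0 h : hom_part c 0 h = 0.
  rewrite hom_part0 -zero_sum ?normr0// => -[//|m] _.
  by rewrite -(scale0r (0 : 'rV[R]_n)) hom_partZ exprS !mul0r.
have ex : exists m, `[< exists h, hom_part c m h != 0 >].
  apply: contrapT => nex; apply: fN0.
  apply/nbhs_normP; exists rho => // h /=; rewrite sub0r normrN => hr.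
  have Pz m : hom_part c m h = 0.
    apply: contrapT => /eqP hm; apply: nex; exists m.
    by apply/asboolP; exists h.
  by rewrite zero_sum.
have [k /asboolP[x0 kx0] kmin] := ex_minnP ex.
exists k, x0; split=> // [|m h mk].
  by case: k kx0 {kmin} => //; rewrite P0 eqxx.
apply: contrapT => /eqP hm.
have /kmin : `[< exists h, hom_part c m h != 0 >] by apply/asboolP; exists h.
by rewrite leqNgt mk.
Qed.

(** * Lower bound for the integrand on a cone *)

(** Each component of the logarithmic gradient is at most its Euclidean norm and each coordinate of
    [x] at most [Y]; summing the products costs the factor [n]. *)
Lemma log_grad_pow_ge (R : realType) (n : nat) (f : 'rV[R]_n -> R)
    (x : 'rV[R]_n) (B Y : R) :
  0 <= B -> 0 < Y -> `|x| <= Y -> (0 < n)%N ->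
  B * (n%:R * Y) <= `|\sum_(i < n) x 0 i * partial i f x| / `|f x| ->
  B ^+ n <= log_grad_pow f x.
Proof.
move=> B0 Y0 xY n0 H; rewrite /log_grad_pow.
set S := Num.sqrt _.
have S0 : 0 <= S by exact: sqrtr_ge0.
apply: lerXn2r; rewrite ?nnegrE//.
have nY : 0 < n%:R * Y by rewrite mulr_gt0// ltr0n.
rewrite -(ler_pM2r nY); apply: (le_trans H).
rewrite -normf_div mulr_suml (le_trans (ler_norm_sum _ _ _))//.
rewrite mulrCA -[n in n%:R * _]card_ord mulr_natl -sumr_const.
apply: ler_sum => i _; rewrite -mulrA normrM mulrC ler_pM//; last first.
  exact: le_trans (mx_entry_norm_le _ _) xY.
rewrite -sqrtr_sqr ler_wsqrtr// [leRHS](bigD1 i)//= lerDl.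
by apply: sumr_ge0 => j _; exact: sqr_ge0.
Qed.

(* The truncated cone over a small box around a point where the leading
   homogeneous part of [f] does not vanish. *)
Lemma log_grad_pow_cone (R : realType) (n : nat) (f : 'rV[R]_n -> R)
    (U : set 'rV[R]_n) :
  open U -> U 0 -> (forall a, U a -> analytic_at f a) ->
  f 0 = 0 -> ~ (\forall x \near (0 : 'rV[R]_n), f x = 0) ->
  exists (x0 : 'rV[R]_n) (i : 'I_n) (delta t0 kappa : R),
    [/\ 0 < delta < `|x0 0 i| / 4, 0 < t0, 0 < kappa &
      forall t y, 0 < t <= t0 -> `|x0 - y| <= delta ->
        U (t *: y) /\ (kappa / t) ^+ n <= log_grad_pow f (t *: y)].
Proof.
move=> oU U0 fU f0 fN0.
have [c [rho [M [rho0 M0 hP cvP]]]] := analytic_at_bound (fU _ U0).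
have {}cvP h : `|h| < rho -> series (fun m => hom_part c m h) @ \oo --> f h.
  by move=> /cvP; rewrite add0r.
have [k [x0 [k0 Pm Pk]]] := leading_part_exists rho0 cvP f0 fN0.
(* Otherwise [x0 = 0], where a part of positive degree vanishes. This coordinate will separate the
   dyadic pieces. *)
have [i xi] : exists i, x0 0 i != 0.
  apply: contrapT => nx; move/eqP: Pk; apply.
  have -> : x0 = 0 *: x0.
    rewrite scale0r; apply/rowP => i; rewrite [RHS]mxE.
    by apply: contrapT => /eqP xi; apply: nx; exists i.
  by rewrite hom_partZ expr0n gtn_eqF// mul0r.
have n0 : (0 < n)%N by exact: leq_ltn_trans (ltn_ord i).
have xi0 : 0 < `|x0 0 i| by rewrite normr_gt0.
pose c0 : R := `|hom_part c k x0| / 2.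
have Pk0 : 0 < `|hom_part c k x0| by rewrite normr_gt0.
have c00 : 0 < c0 by rewrite divr_gt0.
have c0lt : c0 < `|hom_part c k x0| by rewrite /c0; lra.
have /nbhs_normP[d1 /= d10 Hd1] :
    \forall y \near x0, c0 <= `|hom_part c k y|.
  exact: (cvgr_norm_ge _ (@hom_part_continuous _ _ c k x0)).
have /nbhs_normP[rU /= rU0 HrU] : nbhs (0 : 'rV[R]_n) U by exact: open_nbhs_nbhs.
(* The first bound keeps the leading part at least [c0] on the box; the second makes the dilates of
   the box disjoint. *)
pose delta := Num.min (d1 / 2) (`|x0 0 i| / 8).
have delta0 : 0 < delta by rewrite lt_min; apply/andP; split; lra.
have deltad : delta < d1 by rewrite gt_min; apply/orP; left; lra.
have deltax : delta < `|x0 0 i| / 4 by rewrite gt_min; apply/orP; right; lra.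
pose Y := `|x0| + delta.
have Y0 : 0 < Y by rewrite ltr_wpDl.
(* At [t *: y] the error in the radial derivative is at most [t ^+ k.+1 * K], and [f] is at most
   [t ^+ k * C1] in absolute value. *)
pose K := 2 * M * (4 * (Y / rho)) ^+ k.+1.
have K0 : 0 < K by rewrite !mulr_gt0// exprn_gt0// !mulr_gt0// invr_gt0.
pose C1 := 2 * M * (Y / rho) ^+ k.
have C10 : 0 < C1 by rewrite !mulr_gt0// exprn_gt0// divr_gt0.
(* The three bounds make the error at most half the leading term, give [|x| <= rho / 8], and keep
   [x] inside [U]. *)
pose t0 := Num.min (c0 / 2 / K) (Num.min (rho / 8 / Y) (rU / 2 / Y)).
have t00 : 0 < t0 by rewrite !lt_min !divr_gt0.
have nY : 0 < n%:R * Y by rewrite mulr_gt0// ltr0n.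
(* The constant divides [c0 / 2], from the radial derivative, by [C1], from [f], and by the loss
   [n * Y] of [log_grad_pow_ge]. *)
exists x0, i, delta, t0, (c0 / 2 / C1 / (n%:R * Y)).
split; rewrite ?delta0 ?divr_gt0// => t y /andP[t_gt0 tt0] ydelta.
move: tt0; rewrite !le_min => /and3P[tK trho trU].
have yY : `|y| <= Y.
  rewrite -[y](subKr x0) (le_trans (ler_normB _ _))// /Y.
  exact: lerD.
set x := t *: y.
have nx : `|x| = t * `|y| by rewrite normrZ gtr0_norm.
have xY : `|x| <= t * Y by rewrite nx ler_pM2l.
rewrite ler_pdivlMr// in tK; rewrite ler_pdivlMr// in trho.
rewrite ler_pdivlMr// in trU.
have Ux : U x by apply: HrU => /=; rewrite sub0r normrN; lra.
split=> //.
have [dx Dx] := analytic_at_derive (fU _ Ux).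
have xr8 : `|x| <= rho / 8 by lra.
pose th := `|x| / rho.
have th0 : 0 <= th by rewrite divr_ge0// ltW.
have th2 : 0 <= th <= 2^-1 by rewrite th0 ler_pdivrMr//; lra.
have thY : th <= t * (Y / rho) by rewrite mulrA ler_pM2r ?invr_gt0.
have Px : `|hom_part c k x| = t ^+ k * `|hom_part c k y|.
  by rewrite hom_partZ normrM gtr0_norm ?exprn_gt0.
have Py : c0 <= `|hom_part c k y|.
  by apply: Hd1 => /=; exact: le_lt_trans deltad.
have tk0 : 0 < t ^+ k by exact: exprn_gt0.
have Pxge : t ^+ k * c0 <= `|hom_part c k x| by rewrite Px ler_pM2l.
have eK : 2 * M * (4 * th) ^+ k.+1 <= t ^+ k * (c0 / 2).
  apply: (@le_trans _ _ (t ^+ k * (t * K))); last by rewrite ler_pM2l.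
  have -> : t ^+ k * (t * K) = 2 * M * (4 * (t * (Y / rho))) ^+ k.+1.
    by rewrite /K mulrA -exprSr mulrCA -exprMn; congr (_ * _ ^+ _); ring.
  rewrite ler_pM2l ?mulr_gt0//.
  apply: lerXn2r; rewrite ?nnegrE; last by rewrite ler_pM2l.
    by rewrite mulr_ge0.
  by rewrite !mulr_ge0 ?invr_ge0// ltW.
have Dge := radial_derive_ge rho0 hP cvP k0 (fun m => @Pm m x) xr8 (dx x).
rewrite -/th in Dge.
have xr : `|x| < rho by lra.
have serk : series (fun m => hom_part c m x) k = 0.
  by apply: series_low_zero => m /Pm.
have fle : `|f x| <= t ^+ k * C1.
  have := series_remainder k th2 (fun m => hP m x) (cvP x xr).
  rewrite serk subr0 => /le_trans; apply.
  rewrite /C1 mulrCA ler_pM2l ?mulr_gt0// -exprMn.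
  by apply: lerXn2r; rewrite ?nnegrE// mulr_ge0 ?divr_ge0// ltW.
(* As [y / 0 = 0], the quotient is bounded below only where [f x] is nonzero; here the leading term
   exceeds the remainder. *)
have fgt : 0 < `|f x|.
  have := series_remainder k.+1 th2 (fun m => hP m x) (cvP x xr).
  rewrite seriesSr serk add0r => fP.
  have th4 : 2 * M * th ^+ k.+1 <= 2 * M * (4 * th) ^+ k.+1.
    rewrite ler_pM2l ?mulr_gt0//.
    by apply: lerXn2r; rewrite ?nnegrE//; lra.
  have := lerB_dist (hom_part c k x) (f x); rewrite [leRHS]distrC.
  have : 0 < t ^+ k * c0 by rewrite mulr_gt0.
  lra.
apply: (@log_grad_pow_ge _ _ _ _ _ (t * Y)) => //.
- by rewrite !divr_ge0// ltW.
- by rewrite mulr_gt0.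
rewrite -Dx ler_pdivlMr//.
have -> : c0 / 2 / C1 / (n%:R * Y) / t * (n%:R * (t * Y)) = c0 / 2 / C1.
  by field; rewrite !gt_eqF// ltr0n.
apply: (@le_trans _ _ (c0 / 2 / C1 * (t ^+ k * C1))).
  by rewrite ler_pM2l// !divr_gt0.
have -> : c0 / 2 / C1 * (t ^+ k * C1) = t ^+ k * (c0 / 2).
  by field; rewrite gt_eqF.
by lra.
Qed.

(** * Divergence of the integral *)

Lemma integral_pinfty_of_pieces (d : measure_display) (T : measurableType d)
    (R : realType) (mu : {measure set T -> \bar R}) (D : set T) (f : T -> R)
    (A : nat -> set T) (w : nat -> R) (e : R) :
  (forall x, D x -> 0 <= f x) ->
  (forall j, measurable (A j)) -> trivIset setT A -> (forall j, A j `<=` D) ->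
  (forall j, 0 <= w j) -> (forall j x, A j x -> w j <= f x) ->
  0 < e -> (forall j, e%:E <= (w j)%:E * mu (A j))%E ->
  (\int[mu]_(x in D) (f x)%:E = +oo)%E.
Proof.
move=> f0 mA tA AD w0 wf e0 emu; apply/eqyP => B B0.
rewrite ge0_integralE => [|x Dx]; last by rewrite lee_fin f0.
(* Enough pieces that [N * e >= B]. *)
pose N := (Num.truncn (B / e)).+1.
pose g := sum_nnsfun (fun j => scale_nnsfun (indic_nnsfun R (mA j)) (w0 j)) N.
have gE x : g x = \sum_(j < N) w j * \1_(A j) x.
  by rewrite /g sum_nnsfunE; apply: eq_bigr.
apply: (@le_trans _ _ (sintegral mu g)); last first.
  apply: ereal_sup_ubound; exists g => //= x; rewrite gE patchE.
  (* By disjointness at most one indicator is nonzero at [x], so [g x] is a single [w j] or 0. *)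
  have [[j Ajx]|nA] := pselect (exists j : 'I_N, A j x).
    rewrite mem_set; last exact: AD Ajx.
    rewrite lee_fin (bigD1 j)//= indicE mem_set// mulr1 big1 ?addr0 => [|l lj].
      exact: wf.
    rewrite indicE memNset ?mulr0// => Alx.
    have /trivIsetP/(_ l j I I) := tA; rewrite lj => /(_ isT) lj0.
    by have : (A l `&` A j) x by []; rewrite lj0.
  rewrite big1 => [|j _]; last first.
    by rewrite indicE memNset ?mulr0// => Ajx; apply: nA; exists j.
  by case: ifPn => // /set_mem Dx; rewrite lee_fin f0.
have -> : sintegral mu g = (\sum_(j < N) (w j)%:E * mu (A j))%E.
  rewrite /g /sum_nnsfun.
  rewrite (big_morph (fun h : {nnsfun T >-> R} => sintegral mu h)
    (op1 := adde) (id1 := 0%E)).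
  - apply: eq_bigr => j _; rewrite -(sintegral_indic mu (A j)).
    exact: (sintegralrM mu (w j) (indic_nnsfun R (mA j))).
  - by move=> h1 h2; exact: sintegralD.
  - exact: sintegral0.
apply: (@le_trans _ _ (\sum_(j < N) e%:E)%E); last exact: lee_sum.
rewrite sumEFin lee_fin sumr_const card_ord -mulr_natr mulrC -ler_pdivrMr//.
exact/ltW/truncnS_gt.
Qed.

Lemma measurable_box (R : realType) (n : nat) (a b : 'I_n -> R) :
  measurable [set x : n.-tuple R | forall i, a i < tnth x i <= b i].
Proof.
have -> : [set x : n.-tuple R | forall i, a i < tnth x i <= b i] =
    \bigcap_(i in [set: 'I_n]) ((fun x : n.-tuple R => tnth x i) @^-1` `]a i, b i]).
  apply/seteqP; split=> x /= H i; last by have := H i I; rewrite /= in_itv.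
  by move=> _ /=; rewrite in_itv /=.
apply: fin_bigcap_measurable => [|i _]; first exact: finite_finset.
rewrite -[_ @^-1` _]setTI; apply: measurable_tnth => //.
Qed.

Theorem theorem3p4 (R : realType) (n : nat) (D : set 'rV[R]_n)
    (f : 'rV[R]_n -> R) :
  open D -> D 0 ->
  (forall a, D a -> analytic_at f a) ->
  f 0 = 0 ->
  ~ (\forall x \near (0 : 'rV[R]_n), f x = 0) ->
  forall U : set 'rV[R]_n, open U -> U 0 -> U `<=` D ->
  forall mu : {measure set (n.-tuple R) -> \bar R},
    is_lebesgue_measure mu ->
    (\int[mu]_(t in (@row_of_tuple R n) @^-1` U)
        (log_grad_pow f (row_of_tuple t))%:E = +oo)%E.
Proof.
move=> _ _ fD f0 fN0 U oU U0 UD mu muL.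
have [x0 [i [delta [t0 [kappa [/andP[delta0 deltax] t00 kappa0 cone]]]]]] :=
  log_grad_pow_cone oU U0 (fun a Ua => fD a (UD a Ua)) f0 fN0.
pose t j : R := t0 / 2 ^+ j.
have t_gt0 j : 0 < t j by rewrite divr_gt0// exprn_gt0.
have t_le j : t j <= t0.
  by rewrite ler_pdivrMr ?exprn_gt0// ler_peMr ?(ltW t00)// exprn_ege1// ler1n.
have t_half j l : (j < l)%N -> t l <= t j / 2.
  move=> jl; rewrite /t -mulrA -invfM -exprSr ler_pM2l// lef_pV2 ?posrE ?exprn_gt0//.
  by rewrite ler_weXn2l// ler1n.
(* [A j] is the box of half-width [delta] around [x0], scaled by [t j]. *)
pose a j := [tuple t j * (x0 0 l - delta) | l < n].
pose b j := [tuple t j * (x0 0 l + delta) | l < n].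
pose A j := [set x : n.-tuple R | forall l,
  tnth (a j) l < tnth x l <= tnth (b j) l].
have Adist j x l : A j x -> `|t j * x0 0 l - tnth x l| <= t j * delta.
  move=> /(_ l); rewrite !tnth_mktuple mulrBr mulrDr => /andP[h1 h2].
  by rewrite ler_distlC; apply/andP; split; lra.
have Acone j x : A j x -> U (row_of_tuple x) /\
    (kappa / t j) ^+ n <= log_grad_pow f (row_of_tuple x).
  move=> Ajx.
  have -> : row_of_tuple x = t j *: ((t j)^-1 *: row_of_tuple x).
    by rewrite scalerA mulfV ?gt_eqF// scale1r.
  apply: cone; first by rewrite t_gt0 t_le.
  apply: mx_norm_le => [|l]; first exact: ltW.
  rewrite !mxE -(ler_pM2l (t_gt0 j)) -{1}(gtr0_norm (t_gt0 j)) -normrM.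
  by rewrite mulrBr mulVKf ?gt_eqF// Adist.
(* [A j] has volume [(t j * 2 * delta) ^+ n], so the powers of [t j] cancel and the contribution is
   independent of [j]. *)
apply: (@integral_pinfty_of_pieces _ _ _ _ _ _ A
    (fun j => (kappa / t j) ^+ n) ((kappa * (delta *+ 2)) ^+ n)).
- by move=> x _; rewrite exprn_ge0// sqrtr_ge0.
- by move=> j; exact: measurable_box.
- apply/trivIsetP.
  suff H j l : (j < l)%N -> A j `&` A l = set0.
    move=> j l _ _; rewrite neq_ltn => /orP[/H//|/H]; by rewrite setIC.
  (* A common point would force [(t j - t l) * |x0 0 i| <= (t j + t l) * delta]; with
     [t l <= t j / 2] this gives [|x0 0 i| <= 3 * delta], against [delta < |x0 0 i| / 4]. *)
  move=> jl; apply/seteqP; split=> // x [/(Adist _ _ i) hj /(Adist _ _ i) hl].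
  have tlj := t_half _ _ jl; have tj0 := t_gt0 j.
  have : (t j - t l) * `|x0 0 i| <= (t j + t l) * delta.
    rewrite -[t j - t l]ger0_norm; last by lra.
    rewrite -normrM mulrBl mulrDl (le_trans (ler_distD (tnth x i) _ _))//.
    by rewrite lerD// distrC.
  have : 0 < (t j - t l) * (`|x0 0 i| - 4 * delta) by rewrite mulr_gt0//; lra.
  have : 0 <= (t j / 2 - t l) * delta by rewrite mulr_ge0//; lra.
  have : 0 < t j * delta by rewrite mulr_gt0.
  by lra.
- by move=> j x /Acone[].
- by move=> j; rewrite exprn_ge0// divr_ge0// ltW.
- by move=> j x /Acone[].
- by rewrite exprn_gt0// mulr_gt0// mulrn_wgt0.
- move=> j; rewrite muL => [|l]; last first.
    by rewrite !tnth_mktuple ler_pM2l// lerD2l; lra.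
  rewrite (eq_bigr (fun=> t j * (delta *+ 2))) => [|l _]; last first.
    by rewrite !tnth_mktuple; ring.
  rewrite prodr_const card_ord lee_fin -exprMn.
  by rewrite mulrA divfK// gt_eqF.
Qed.
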